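(* Let $G$ be a locally indicable group or a torsion-free residually finite group. Then $G$ is weakly algebraically hyperbolic (weakly AH) if and only if $G$ is algebraically hyperbolic (AH).
   Context: A group is locally cyclic if each of its non-trivial finitely generated subgroups is isomorphic to $\mathbb{Z}$ (equivalently, it is isomorphic to a subgroup of $(\mathbb{Q},+)$). A group $G$ is commutative-transitive if for all $g,h,k\in G\smallsetminus\{1\}$, $[g,h]=1$ and $[h,k]=1$ imply $[g,k]=1$. A torsion-free group $G$ is algebraically hyperbolic (AH) if (a) $G$ is commutative-transitive, and (b) $G$ contains no subgroup of the form $H\rtimes\mathbb{Z}$ with $H$ non-trivial locally cyclic. A group $G$ is weakly algebraically hyperbolic (weakly AH) if it contains no subgroup isomorphic to $\mathbb{Z}^2$ and for every non-trivial $x\in G$ and all $m,n\in\mathbb{Z}$, if $x^m$ and $x^n$ are conjugate in $G$ then $|m|=|n|$. A group $G$ is locally indicable if every non-trivial finitely generated subgroup of $G$ surjects onto $\mathbb{Z}$. A group is residually finite if the intersection of all its finite-index subgroups is trivial. *)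

(* Defs.v *)
(* [groupType] is an arbitrary, possibly infinite, multiplicative group;
   subgroups are Prop-valued sets. *)
From HB Require Import structures.
From mathcomp Require Import all_boot all_order all_algebra.
From mathcomp Require Import boolp classical_sets functions cardinality.

Set Implicit Arguments.
Unset Strict Implicit.
Unset Printing Implicit Defensive.

Local Open Scope classical_set_scope.
Local Open Scope group_scope.

(* The infinite cyclic group; its law [*] is the addition of [int]. *)
Notation Zgroup := (Algebra.to_multiplicative int).

Definition expgz (G : groupType) (x : G) (m : int) : G :=
  match m with
  | Posz n => x ^+ n
  | Negz n => x ^- n.+1
  end.

Definition subgroup (G : groupType) (H : set G) : Prop := group_closed [in H].

Definition generated (G : groupType) (S : set G) : set G :=
  smallest (@subgroup G) S.

Definition finitely_generated (G : groupType) (H : set G) : Prop :=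
  exists2 S : set G, finite_set S & H = generated S.

(* When [H] is the carrier of a subgroup of [G], this says that this subgroup
   is isomorphic to [K]. *)
Definition isomorphic_to (G : groupType) (H : set G) (K : groupType) : Prop :=
  exists f : {multiplicative K -> G}, set_bij [set: K] H f.

(* Only the restriction of [f] to [H] matters: it is an epimorphism from the
   subgroup [H] onto Z. *)
Definition surjects_onto_Z (G : groupType) (H : set G) : Prop :=
  exists2 f : G -> Zgroup,
    {in H &, {morph f : x y / x * y}} & f @` H = [set: Zgroup].

Definition torsion_free (G : groupType) : Prop :=
  forall (x : G) (n : nat), x != 1 -> (0 < n)%N -> x ^+ n != 1.

Definition finite_index (G : groupType) (H : set G) : Prop :=
  finite_set [set [set x * h | h in H] | x in [set: G]].

Definition residually_finite (G : groupType) : Prop :=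
  \bigcap_(H in [set H : set G | subgroup H /\ finite_index H]) H = [set 1].

Definition locally_indicable (G : groupType) : Prop :=
  forall H : set G, finitely_generated H -> H <> [set 1] -> surjects_onto_Z H.

(* Local cyclicity of the subgroup [A] of [G]. *)
Definition locally_cyclic (G : groupType) (A : set G) : Prop :=
  forall H : set G, H `<=` A -> finitely_generated H -> H <> [set 1] ->
    isomorphic_to H Zgroup.

Definition commutative_transitive (G : groupType) : Prop :=
  forall g h k : G, g != 1 -> h != 1 -> k != 1 ->
    [~ g, h] = 1 -> [~ h, k] = 1 -> [~ g, k] = 1.

(* [L] is the internal semidirect product of its subgroups [N] (normal) and
   [K]; the action of [K] on [N] by conjugation may be trivial. *)
Definition is_semidirect_product (G : groupType) (N K L : set G) : Prop :=
  [/\ subgroup N, subgroup K,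
      forall x y, N x -> K y -> N (x ^ y),
      N `&` K = [set 1]
    & L = [set x * y | x in N & y in K]].

Definition algebraically_hyperbolic (G : groupType) : Prop :=
  [/\ torsion_free G,
      commutative_transitive G
    & ~ exists L N K : set G,
          [/\ subgroup L, is_semidirect_product N K L,
              N <> [set 1], locally_cyclic N & isomorphic_to K Zgroup]].

Definition weakly_algebraically_hyperbolic (G : groupType) : Prop :=
  (~ exists H : set G, subgroup H /\ isomorphic_to H (Zgroup * Zgroup)%type)
  /\ forall x : G, x != 1 -> forall m n : int,
       (exists g : G, expgz x m ^ g = expgz x n) -> `|m|%N = `|n|%N.

(* Main.v *)
From HB Require Import structures.
From mathcomp Require Import all_boot all_order all_algebra.
From mathcomp Require Import boolp classical_sets functions cardinality.
From mathcomp Require Import all_fingroup all_solvable.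
From mathcomp Require Import zify.
Require Import Defs.

(** Write AH for algebraically hyperbolic.  Commutation drives both directions:
    in a torsion-free group without Z^2, two commuting non-trivial elements are
    commensurable ([weakly_AH_commensurable]), and two commuting commensurable
    elements are powers of a common one ([common_root]).

    AH implies weakly AH.  A copy of Z^2 is already a product of Z by Z.  If
    [expgz x m ^ g = expgz x n] with [x != 1] and |m| <> |n|, consider the
    isolator of [x], the set of elements having a non-zero power in <x>.
    Commutative transitivity makes it an abelian subgroup, [common_root] makes
    it locally cyclic, and the relation makes it invariant under conjugation
    by [g].  As AH forbids [isolator x] extended by an infinite cyclic group
    meeting it trivially, some non-zero power of [g] lies in the isolator; so
    [g] commutes with [x], whence [m = n].

    Weakly AH implies AH.  If an element [t] of infinite order normalizes a
    locally cyclic [N] with [<t>] meeting [N] trivially, and [1 != x] is in [N],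
    then [x] and [x ^ t] are powers [b], [a] of a common element, so [t]
    conjugates [x ^ b] to [x ^ a]; hence |a| = |b|, [x ^ t] is [x] or its
    inverse, and [x], [t ^ 2] generate Z^2.  This settles the semidirect
    products, and it remains to see that the centralizer of any [z != 1] is
    abelian.  Every element of it is commensurable with [z].

    - Locally indicable case.  Given [g], [h] commuting with [z], map <z, g, h>
      onto Z.  By commensurability [z] has a non-zero image, and then so has
      every non-trivial element; but [[~ g, h]] is mapped to 0.

    - Residually finite case.  If [c = [~ g, h]] were non-trivial, then
      [expgz c a = expgz z b] with [b] non-zero.  Take a finite quotient in
      which [expgz z (b * 2)] survives, and let [F] be the image of the
      centralizer of [z].  In [F], each element lies in a cyclic subgroup
      containing the image of [z].  Hence a Sylow subgroup of [F] is
      cyclic as soon as the corresponding part of the image of [z] has order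
      greater than 2 ([cyclic_Sylow_of_central_roots]).  The transfer into
      an abelian Sylow subgroup shows that it contains no non-trivial element
      that is both central in [F] and in its derived subgroup
      ([abelian_Sylow_center_der1]).  So elements of <z> in the derived
      subgroup of [F] have order at most 2 ([central_cycle_der1]),
      contradicting the choice of [F].  *)

Set Implicit Arguments.
Unset Strict Implicit.
Unset Printing Implicit Defensive.

Import GRing.Theory FiniteModule.

Local Open Scope classical_set_scope.
Local Open Scope group_scope.

(** * Integer powers *)

Section IntegerPowers.
Variable G : groupType.
Implicit Types (x y g : G) (m n : int).

Lemma expgz0 x : expgz x 0 = 1.
Proof. by []. Qed.

Lemma expgz1 x : expgz x 1 = x.
Proof. by []. Qed.

(** Writing an exponent as a difference of natural numbers avoids the case
    analysis on signs in the exponent laws. *)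
Lemma expgz_subn x (a b : nat) :
  expgz x (a%:Z - b%:Z)%R = x ^+ a * x ^- b.
Proof.
case: (leqP b a) => [le_ba | /ltnW le_ab].
  by rewrite subzn //= expgnFr.
rewrite -[(a%:Z - _)%R]opprB subzn //.
have -> : expgz x (- (b - a)%:Z)%R = x ^- (b - a).
  by case: (b - a) => [|k] //=; rewrite invg1.
by rewrite expgnFr // invgF.
Qed.

Lemma int_subn m : exists a b : nat, m = (a%:Z - b%:Z)%R.
Proof.
case: m => k; first by exists k, 0; rewrite subr0.
by exists 0, k.+1; rewrite sub0r NegzE.
Qed.

Lemma expgzD x m n : expgz x (m + n)%R = expgz x m * expgz x n.
Proof.
have [a [b ->]] := int_subn m; have [c [d ->]] := int_subn n.
have -> : (a%:Z - b%:Z + (c%:Z - d%:Z) = (a + c)%:Z - (b + d)%:Z)%R by lia.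
rewrite !expgz_subn [(b + d)%N]addnC !expgnDr -!mulgA; congr (_ * _).
rewrite invgM !mulgA; congr (_ * _).
have cx i j : commute (x ^+ i) (x ^+ j) by apply: commuteX2.
by rewrite (commuteV (cx c b)).
Qed.

Lemma expgzN x m : expgz x (- m)%R = (expgz x m)^-1.
Proof.
apply/esym/mulg1_eq; rewrite -expgzD.
by have -> : (m + - m = 0)%R by lia.
Qed.

Lemma expgzM x m n : expgz x (m * n)%R = expgz (expgz x m) n.
Proof.
elim: n => [|n IH|n IH]; first by rewrite mulr0.
  have -> : (m * n.+1%:Z = m + m * n%:Z)%R by lia.
  by rewrite expgzD IH /= expgS.
have -> : (m * - n.+1%:Z = - (m * n.+1%:Z))%R by lia.
have -> : (m * n.+1%:Z = m - (m * - n%:Z))%R by lia.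
rewrite !expgzN expgzD expgzN IH expgzN invgK.
by have -> : (n.+1%:Z = 1 + n%:Z)%R by []; rewrite expgzD expgz1.
Qed.

Lemma commute_expgz x y m n : commute x y -> commute (expgz x m) (expgz y n).
Proof.
have cV u v i : commute u v -> commute u (expgz v i).
  by case: i => k cuv /=; [apply: commuteX | apply/commuteV/commuteX].
by move=> cxy; apply/cV/commute_sym/cV/commute_sym.
Qed.

Lemma expgzC x m n : commute (expgz x m) (expgz x n).
Proof. exact: commute_expgz. Qed.

Lemma expgzMl x y m : commute x y -> expgz (x * y) m = expgz x m * expgz y m.
Proof.
move=> cxy; case: m => k /=; rewrite expgMn // invgM.
by have := commute_expgz (Negz k) (Negz k) cxy.
Qed.

Lemma conj_expgz x g m : expgz x m ^ g = expgz (x ^ g) m.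
Proof. by case: m => k /=; rewrite ?conjVg conjXg. Qed.

Lemma expgz1n m : expgz (1 : G) m = 1.
Proof. by case: m => k /=; rewrite expg1n ?invg1. Qed.

Lemma expgz_eq1 x m : torsion_free G -> x != 1 -> expgz x m = 1 -> m = 0%R.
Proof.
move=> tfG x1; case: m => [[|k]|k] //= /eqP; last rewrite invg_eq1.
  by rewrite (negPf (tfG _ _ x1 _)).
by rewrite (negPf (tfG _ _ x1 _)).
Qed.

End IntegerPowers.

(** * Subgroups, infinite cyclic groups and morphisms *)

Lemma subgroupP (G : groupType) (H : set G) :
  subgroup H <-> H 1 /\ forall x y, H x -> H y -> H (x * y^-1).
Proof.
have memH x : (x \in [in H]) = (x \in H) by [].
split=> [[H1 HF]|[H1 HF]].
  split; first by move: H1; rewrite memH => /set_mem.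
  move=> x y /mem_set Hx /mem_set Hy; apply: set_mem.
  by have := HF x y; rewrite !memH; apply.
split; first by rewrite memH; apply: mem_set.
by move=> x y; rewrite !memH => /set_mem Hx /set_mem Hy; apply/mem_set/HF.
Qed.

Lemma subgroup1 (G : groupType) (H : set G) : subgroup H -> H 1.
Proof. by case/subgroupP. Qed.

Lemma subgroupV (G : groupType) (H : set G) x :
  subgroup H -> H x -> H x^-1.
Proof. by case/subgroupP=> H1 HF Hx; rewrite -[x^-1]mul1g; apply: HF. Qed.

Lemma subgroupM (G : groupType) (H : set G) x y :
  subgroup H -> H x -> H y -> H (x * y).
Proof.
move=> sgH Hx Hy; rewrite -[y]invgK; have [_ HF] := (subgroupP H).1 sgH.
by apply: HF => //; apply: subgroupV.
Qed.

Lemma subgroup_expgz (G : groupType) (H : set G) x m :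
  subgroup H -> H x -> H (expgz x m).
Proof.
move=> sgH Hx; have HX k : H (x ^+ k).
  by elim: k => [|k IH]; [apply: subgroup1 | rewrite expgS; apply: subgroupM].
by case: m => k; [apply: HX | apply: (subgroupV sgH (HX _))].
Qed.

Lemma morph_in_expgz (G K : groupType) (H : set G) (f : G -> K) :
  subgroup H -> {in H &, {morph f : x y / x * y}} ->
  forall x m, H x -> f (expgz x m) = expgz (f x) m.
Proof.
move=> sgH fM x m Hx.
have {}fM u v : H u -> H v -> f (u * v) = f u * f v.
  by move=> Hu Hv; apply: fM; apply: mem_set.
have f1 : f 1 = 1.
  by apply: (mulgI (f 1)); rewrite -fM ?mulg1 //; exact: subgroup1.
have HX k : H (x ^+ k) by exact: (subgroup_expgz (Posz k)).
have fX k : f (x ^+ k) = f x ^+ k.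
  by elim: k => // k IH; rewrite !expgS fM ?IH.
case: m => k /=; first exact: fX.
rewrite -fX; apply/esym/mulg1_eq; rewrite -fM ?mulgV //.
by exact: (subgroupV sgH).
Qed.

Lemma morph_expgz (G K : groupType) (f : G -> K) :
  {morph f : x y / x * y} -> forall x m, f (expgz x m) = expgz (f x) m.
Proof.
move=> fM x m; apply: (morph_in_expgz (H := setT)) => //.
exact/subgroupP.
Qed.

Lemma subgroup_commg (G : groupType) (H : set G) x y :
  subgroup H -> H x -> H y -> H [~ x, y].
Proof.
move=> sgH Hx Hy; have [HVx HVy] := (subgroupV sgH Hx, subgroupV sgH Hy).
exact: (subgroupM sgH HVx (subgroupM sgH HVy (subgroupM sgH Hx Hy))).
Qed.

Lemma subgroup_centralizer (G : groupType) (z : G) :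
  subgroup [set y : G | commute y z].
Proof.
apply/subgroupP; split; first by rewrite /= /commute mul1g mulg1.
move=> u v cu cv; apply/commute_sym/commuteM; first exact/commute_sym.
exact/commuteV/commute_sym.
Qed.

Lemma isomorphic_to_range (G K : groupType) (f : K -> G) (H : set G) :
  {morph f : x y / x * y} -> injective f -> H = range f -> isomorphic_to H K.
Proof.
move=> fM finj ->.
pose F : {multiplicative K -> G} :=
  HB.pack f (isMultiplicative.Build K G f fM).
exists F; split; first by move=> x _; exists x.
  by move=> x y _ _; apply: finj.
by [].
Qed.

Lemma isomorphic_toE (G K : groupType) (H : set G) :
  isomorphic_to H K -> exists f : K -> G,
    [/\ {morph f : x y / x * y}, injective f & H = range f].
Proof.
case=> f [fH finj fsurj]; exists f; split.
- exact: gmulfM.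
- by move=> x y; apply: finj; apply: in_setT.
by apply/seteqP; split=> [y /fsurj|_ [x _ <-]] //; apply: fH.
Qed.

Lemma expgz_int (m : int) : expgz (1%R : Zgroup) m = m.
Proof.
have nat_case (k : nat) : ((1%R : Zgroup) ^+ k) = Posz k.
  by elim: k => // k IH; rewrite expgS IH.
by case: m => k; rewrite /expgz nat_case ?NegzE.
Qed.

Lemma expgz_Zgroup (k : Zgroup) (m : int) : expgz k m = (m * (k : int))%R.
Proof. by rewrite -[k in LHS]expgz_int -expgzM expgz_int mulrC. Qed.

Lemma isomorphic_to_Z (G : groupType) (H : set G) :
  isomorphic_to H Zgroup -> exists2 w : G, H = range (expgz w) &
    injective (expgz w).
Proof.
case/isomorphic_toE=> f [fM finj ->].
have fE m : f m = expgz (f (1%R : int)) m.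
  by rewrite -(morph_expgz fM) expgz_int.
exists (f (1%R : int)); last by move=> m n; rewrite -!fE; apply: finj.
by congr image; apply/funext.
Qed.

Lemma subgroup_range (G K : groupType) (f : K -> G) :
  {morph f : x y / x * y} -> subgroup (range f).
Proof.
move=> fM; have f1 : f 1 = 1 by apply: (mulgI (f 1)); rewrite -fM !mulg1.
apply/subgroupP; split; first by exists 1.
move=> _ _ [a _ <-] [b _ <-]; exists (a * b^-1) => //.
by rewrite fM; congr (_ * _); apply/esym/mulg1_eq; rewrite -fM mulgV.
Qed.

Lemma subgroup_cycle (G : groupType) (w : G) : subgroup (range (expgz w)).
Proof. exact: (subgroup_range (K := Zgroup) (expgzD w)). Qed.

Lemma subgroup_generated (G : groupType) (S : set G) : subgroup (generated S).
Proof.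
apply/subgroupP; split=> [H [/subgroup1 //]|x y Sx Sy H HS].
have [_] := (subgroupP H).1 HS.1; apply; [exact: Sx | exact: Sy].
Qed.

Lemma sub_generated (G : groupType) (S : set G) : S `<=` generated S.
Proof. by move=> x Sx H [_]; apply. Qed.

Lemma generated_sub (G : groupType) (S H : set G) :
  subgroup H -> S `<=` H -> generated S `<=` H.
Proof. by move=> sgH SH x; apply. Qed.

Lemma morph_inj (G K : groupType) (f : K -> G) :
  {morph f : x y / x * y} -> (forall x, f x = 1 -> x = 1) -> injective f.
Proof.
move=> fM f1 x y efxy; apply/divg1_eq/f1/(mulIg (f y)).
by rewrite -fM mulgVK mul1g.
Qed.

Lemma cycle_iso_Z (G : groupType) (w : G) :
  torsion_free G -> w != 1 -> isomorphic_to (range (expgz w)) Zgroup.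
Proof.
move=> tfG w1; apply: (isomorphic_to_range (K := Zgroup) (f := expgz w)) => //.
  exact: expgzD.
by apply: morph_inj => [|m]; [exact: expgzD | exact: expgz_eq1].
Qed.

(** * Commensurable elements *)

(** Divide [a] and [b] by their gcd, which torsion-freeness allows; a Bezout
    relation between the quotients then gives the exponents of [x] and [y] in
    the common root [w].  That [w] lies in <x, y> is what lets the lemma serve
    for computing generators of subgroups. *)
Lemma common_root (G : groupType) (x y : G) (a b : int) :
  torsion_free G -> commute x y -> a != 0%R -> expgz x a = expgz y b ->
  exists w, [/\ exists u v, w = expgz x u * expgz y v,
                exists i, x = expgz w i & exists j, y = expgz w j].
Proof.
move=> tfG cxy a0 exy; set d := gcdz a b.
have d0 : d != 0%R by rewrite gcdz_eq0 negb_and a0.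
have /dvdzP[a' ea] : (d %| a)%Z by apply: dvdz_gcdl.
have /dvdzP[b' eb] : (d %| b)%Z by apply: dvdz_gcdr.
have [u [v euv]] := Bezoutz a b.
have {}euv : (u * a' + v * b' = 1)%R.
  by apply: (mulIf d0); rewrite mulrDl -!mulrA -ea -eb euv mul1r.
have {}exy : expgz x a' = expgz y b'.
  apply/divg1_eq/eqP/contraT => ne1; case/eqP: d0.
  apply: (expgz_eq1 tfG ne1); rewrite expgzMl; last first.
    by apply/commuteV/commute_expgz.
  by rewrite -expgzN -!expgzM mulNr -ea -eb exy expgzN mulgV.
exists (expgz x v * expgz y u); split; first by exists v, u.
  exists b'; rewrite expgzMl; last exact: commute_expgz.
  rewrite -!expgzM [(u * b')%R]mulrC [expgz y _]expgzM -exy -expgzM -expgzD.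
  by rewrite [(a' * u)%R]mulrC addrC euv.
exists a'; rewrite expgzMl; last exact: commute_expgz.
rewrite -!expgzM [(v * a')%R]mulrC [expgz x _]expgzM exy -expgzM -expgzD.
by rewrite [(b' * v)%R]mulrC addrC euv.
Qed.

Lemma Z2_subgroup (G : groupType) (x y : G) :
  commute x y ->
  (forall a b, expgz x a * expgz y b = 1 -> a = 0%R /\ b = 0%R) ->
  exists H : set G, subgroup H /\ isomorphic_to H (Zgroup * Zgroup)%type.
Proof.
move=> cxy ind; pose f (p : Zgroup * Zgroup) := expgz x p.1 * expgz y p.2.
have fM : {morph f : p q / p * q}.
  move=> [a b] [c d]; rewrite /f /= !expgzD -!mulgA; congr (_ * _).
  by rewrite !mulgA; congr (_ * _); apply: commute_expgz.
exists (range f); split; first exact: subgroup_range.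
apply: (isomorphic_to_range fM) => //.
by apply: morph_inj => // -[a b] fab; have [/= -> ->] := ind _ _ fab.
Qed.

Lemma expgz_inj (G : groupType) (x : G) :
  torsion_free G -> x != 1 -> injective (expgz x).
Proof.
move=> tfG x1; apply: (morph_inj (K := Zgroup)); first exact: expgzD.
by move=> m; apply: expgz_eq1.
Qed.

(** By [common_root], two generators can be replaced by one, hence so can any
    finite number of them. *)
Lemma locally_cyclic_commensurable (G : groupType) (A : set G) :
  torsion_free G ->
  (forall x y, A x -> A y -> x != 1 -> y != 1 ->
    commute x y /\ exists a b : int, a != 0%R /\ expgz x a = expgz y b) ->
  locally_cyclic A.
Proof.
move=> tfG comA H sHA [S /finite_seqP[s eS] eH] H1.
have sgH : subgroup H by rewrite eH; apply: subgroup_generated.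
have [w Hw sw] : exists2 w, H w & forall z, z \in s -> exists i, z = expgz w i.
  have : forall z, z \in s -> H z.
    by move=> z sz; rewrite eH; apply: sub_generated; rewrite eS.
  elim: s {eS} => [|z s IH] sH; first by exists 1; [apply: subgroup1|].
  have [|w Hw sw] := IH; first by move=> y sy; apply: sH; rewrite inE sy orbT.
  have Hz : H z by apply: sH; rewrite mem_head.
  have [z1|z1] := eqVneq z 1.
    exists w => // y; rewrite inE => /predU1P[->|/sw//].
    by exists 0%R; rewrite expgz0.
  have [w1|w1] := eqVneq w 1.
    exists z => // y; rewrite inE => /predU1P[->|/sw[i ->]].
      by exists 1%R.
    by exists 0%R; rewrite w1 expgz1n.
  have [czw [a [b [a0 ezw]]]] := comA z w (sHA _ Hz) (sHA _ Hw) z1 w1.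
  have [t [[u [v et]] zt [j wt]]] := common_root tfG czw a0 ezw.
  exists t; first by rewrite et; apply: subgroupM => //; apply: subgroup_expgz.
  move=> y; rewrite inE => /predU1P[->//|/sw[i ->]].
  by exists (j * i)%R; rewrite expgzM -wt.
have eHw : H = range (expgz w).
  apply/seteqP; split; last by move=> _ [i _ <-]; apply: subgroup_expgz.
  rewrite {1}eH; apply: generated_sub; first exact: subgroup_cycle.
  by move=> z; rewrite eS => /sw[i ->]; exists i.
rewrite eHw; apply: cycle_iso_Z => //; apply/eqP => w1; apply: H1.
rewrite eHw w1; apply/seteqP; split=> [_ [i _ <-]|_ ->].
  by rewrite expgz1n.
by exists 0%R.
Qed.

(** * Algebraically hyperbolic groups are weakly so *)

(** Otherwise <g> would be infinite cyclic and meet [N] trivially, and N<g>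
    would be one of the semidirect products that are excluded. *)
Lemma no_normalized_locally_cyclic (G : groupType) (N : set G) (g : G) :
  algebraically_hyperbolic G -> subgroup N -> N <> [set 1] ->
  locally_cyclic N -> (forall x, N (x ^ g) <-> N x) ->
  exists2 k : int, k != 0%R & N (expgz g k).
Proof.
move=> [tfG _ noHZ] sgN N1 lcN Ng; apply: contrapT => noN; apply: noHZ.
have g1 : g != 1.
  apply/eqP => g1; apply: noN; exists 1%R => //.
  by rewrite expgz1 g1; apply: subgroup1.
pose D := [set h : G | forall x, N (x ^ h) <-> N x].
have sgD : subgroup D.
  apply/subgroupP; split; first by move=> x; rewrite conjg1.
  move=> h k Dh Dk x; rewrite conjgM; apply: iff_trans (Dh x).
  by apply: iff_sym; rewrite -{1}[x ^ h](conjgKV k); apply: Dk.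
have NK x k : N x -> N (x ^ expgz g k).
  by move=> Nx; apply/(subgroup_expgz k sgD Ng).
pose K := range (expgz g); have sgK : subgroup K := subgroup_cycle g.
exists [set x * y | x in N & y in K], N, K; split=> //.
- apply/subgroupP; split.
    exists 1; first exact: (subgroup1 sgN).
    by exists 1; [exact: (subgroup1 sgK) | rewrite mulg1].
  move=> _ _ [x Nx [_ [i _ <-] <-]] [y Ny [_ [j _ <-] <-]].
  pose k := (j - i)%R.
  exists (x * (y^-1 ^ expgz g k)).
    by apply: (subgroupM sgN Nx); apply/NK/(subgroupV sgN).
  exists (expgz g (- k)); first by exists (- k)%R.
  rewrite expgzN conjgE !mulgA mulgK invgM !mulgA -expgzN.
  congr (_ * _); rewrite -mulgA -[in RHS]expgzN -expgzD; congr (_ * expgz g _).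
  by rewrite /k; lia.
- split=> //; first by move=> x y Nx [k _ <-]; apply: NK.
  apply/seteqP; split=> [h [/= Nh [k _ ek]]|_ ->]; last first.
    by split; exact: subgroup1.
  have [k0|k0] := eqVneq k 0%R; first by rewrite /= -ek k0.
  by case: noN; exists k; rewrite // ek.
- exact: cycle_iso_Z.
Qed.

(** The elements having a power of non-zero exponent in <x>.  In a torsion-free
    commutative-transitive group this is a subgroup, the largest one containing
    <x> in which every non-trivial element is commensurable with [x]. *)
Definition isolator (G : groupType) (x : G) : set G :=
  [set y | exists a b : int, a != 0%R /\ expgz y a = expgz x b].

Section Isolator.
Variables (G : groupType) (x : G).
Hypotheses (tfG : torsion_free G) (ctG : commutative_transitive G).
Hypothesis x1 : x != 1.

(** A non-trivial [y] commutes with its power [expgz y a], which as a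
    non-trivial power of [x] commutes with [x]. *)
Lemma isolator_commutel y : isolator x y -> commute y x.
Proof.
case=> a [b [a0 eyx]]; have [->|y1] := eqVneq y 1.
  by rewrite /commute mul1g mulg1.
have ya1 : expgz y a != 1.
  by apply: contra a0 => /eqP/(expgz_eq1 tfG y1)->.
apply/commgP/eqP; apply: (ctG y1 ya1 x1); apply/eqP/commgP.
  exact: (expgzC y 1 a).
by rewrite eyx; apply: (expgzC x b 1).
Qed.

Lemma isolator_commute y z : isolator x y -> isolator x z -> commute y z.
Proof.
move=> Ny Nz; have [->|y1] := eqVneq y 1; first by rewrite /commute mul1g mulg1.
have [->|z1] := eqVneq z 1; first by rewrite /commute mul1g mulg1.
apply/commgP/eqP; apply: (ctG y1 x1 z1); apply/eqP/commgP.
  exact: isolator_commutel.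
exact/commute_sym/isolator_commutel.
Qed.

Lemma subgroup_isolator : subgroup (isolator x).
Proof.
apply/subgroupP; split; first by exists 1%R, 0%R.
move=> y z Ny Nz; have cyz := isolator_commute Ny Nz.
case: Ny Nz => a [b [a0 ey]] [c [d [c0 ez]]].
exists (a * c)%R, (b * c - d * a)%R; split; first by rewrite mulf_neq0.
rewrite expgzMl; last exact: commuteV.
have zV : z^-1 = expgz z (- 1)%R by [].
rewrite zV -expgzM [(-1 * _)%R]mulN1r [(a * c)%R in X in _ * X]mulrC.
by rewrite !expgzN !expgzM ey expgzD expgzN !expgzM ez.
Qed.

Lemma locally_cyclic_isolator : locally_cyclic (isolator x).
Proof.
apply: locally_cyclic_commensurable => // y z Ny Nz y1 z1.
split; first exact: isolator_commute.
case: Ny Nz => a [b [a0 ey]] [c [d [c0 ez]]].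
exists (a * d)%R, (c * b)%R; split; last first.
  by rewrite !expgzM ey ez -!expgzM mulrC.
rewrite mulf_neq0 //; apply/eqP => d0; move: ez; rewrite d0 expgz0.
by move/(expgz_eq1 tfG z1)/eqP; rewrite (negPf c0).
Qed.

(** Raising [expgz y a = expgz x b] to the power [m] and conjugating by [g]
    turns it into a relation between [y ^ g] and [x], and conversely with
    [n]. *)
Lemma isolator_conj g m n : m != 0%R -> n != 0%R ->
  expgz x m ^ g = expgz x n ->
  forall y, isolator x (y ^ g) <-> isolator x y.
Proof.
move=> m0 n0 exg y; split=> -[a [b [a0 ey]]].
  exists (a * n)%R, (m * b)%R; split; first by rewrite mulf_neq0.
  apply: (@conjg_inj _ g).
  rewrite !expgzM !conj_expgz ey -conj_expgz exg -!expgzM; congr expgz.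
  exact: mulrC.
exists (a * m)%R, (n * b)%R; split; first by rewrite mulf_neq0.
by rewrite !expgzM -exg -!conj_expgz ey -!expgzM mulrC.
Qed.

End Isolator.

Lemma AH_weakly_AH (G : groupType) :
  algebraically_hyperbolic G -> weakly_algebraically_hyperbolic G.
Proof.
move=> ahG; have [tfG ctG _] := ahG; split.
  case=> H [sgH /isomorphic_toE[f [fM finj _]]].
  pose e1 : Zgroup * Zgroup := (1%R : int, 0%R : int).
  pose e2 : Zgroup * Zgroup := (0%R : int, 1%R : int).
  pose x := f e1; pose y := f e2.
  have fE a b : expgz x a * expgz y b = f (a, b).
    rewrite -!(morph_expgz fM) -fM; congr f.
    have pE (p : Zgroup * Zgroup) m : expgz p m = (expgz p.1 m, expgz p.2 m).
      rewrite [LHS]surjective_pairing; congr (_, _).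
        exact: (morph_expgz (f := fst)).
      exact: (morph_expgz (f := snd)).
    rewrite !pE /= !expgz_int !expgz1n; congr (_, _).
      exact: mulg1.
    exact: mul1g.
  have f1 : f (0%R : int, 0%R : int) = 1 by rewrite -fE mul1g.
  have cxy : commute x y.
    by rewrite /commute -!fM; congr (f (_, _)); rewrite /= mulg1 mul1g.
  have x1 : x != 1 by apply/eqP; rewrite -f1 => /finj.
  pose N := range (expgz x).
  have [||||k k0 [a _ eak]] := @no_normalized_locally_cyclic G N y ahG.
  - exact: subgroup_cycle.
  - move=> N1; case/eqP: x1; have : N x by exists 1%R.
    by rewrite N1.
  - apply: locally_cyclic_commensurable => // _ _ [i _ <-] [j _ <-] _ yj1.
    split; first exact: expgzC.
    exists j, i; split; last by rewrite -!expgzM mulrC.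
    by apply: contra yj1 => /eqP->; rewrite expgz0.
  - have Ny z : N z -> z ^ y = z.
      case=> i _ <-; apply/conjg_fixP/eqP/eqP/commgP.
      exact: (commute_expgz i 1 cxy).
    move=> z; split=> [Nzy|Nz]; last by rewrite Ny.
    suff <- : z ^ y = z by [].
    by apply: (@conjg_inj _ y); rewrite [LHS]Ny.
  move: k0; suff -> : k = 0%R by [].
  have := fE (- a)%R k; rewrite -eak -expgzD addNr expgz0 -f1 => /esym/finj.
  by case.
move=> x x1 m n [g exg]; apply: contrapT => neq_mn.
have m0 : m != 0%R.
  apply/eqP => m0; apply: neq_mn; move: exg.
  by rewrite m0 expgz0 conj1g => /esym/(expgz_eq1 tfG x1)->.
have n0 : n != 0%R.
  apply/eqP => n0; apply: neq_mn; move/eqP: exg.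
  by rewrite n0 expgz0 conjg_eq1 => /eqP/(expgz_eq1 tfG x1)->.
(* Otherwise [expgz x m = expgz x n], and [x] has infinite order. *)
have cgx : ~ commute g x.
  move=> cgx; apply: neq_mn; congr absz; apply: (expgz_inj tfG x1).
  rewrite -exg; apply/esym/conjg_fixP/commgP.
  exact: (commute_expgz m 1 (commute_sym cgx)).
have [||||k k0 Nk] := @no_normalized_locally_cyclic G (isolator x) g ahG.
- exact: subgroup_isolator.
- move=> N1; case/eqP: x1; have : isolator x x by exists 1%R, 1%R.
  by rewrite N1.
- exact: locally_cyclic_isolator.
- exact: isolator_conj exg.
have g1 : g != 1.
  by apply/eqP => g1; apply: cgx; rewrite g1 /commute mul1g mulg1.
have gk1 : expgz g k != 1.
  by apply/eqP => /(expgz_eq1 tfG g1)/eqP; rewrite (negPf k0).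
apply/cgx/commgP/eqP/(ctG _ _ _ g1 gk1 x1); apply/eqP/commgP.
  exact: (expgzC g 1 k).
exact: isolator_commutel.
Qed.

(** * Commensurability and semidirect products in weakly AH groups *)

(** If [x ^+ n = 1], the powers of [x] with exponents [n] and 0 coincide. *)
Lemma weakly_AH_torsion_free (G : groupType) :
  weakly_algebraically_hyperbolic G -> torsion_free G.
Proof.
case=> _ wG x n x1 n_gt0; apply/eqP => xn.
have n0 : n = 0 by apply: (wG x x1 (Posz n) 0%R); exists 1; rewrite conjg1.
by rewrite n0 in n_gt0.
Qed.

Section WeaklyAH.
Variable G : groupType.
Hypothesis wG : weakly_algebraically_hyperbolic G.
Let tfG := weakly_AH_torsion_free wG.

Lemma weakly_AH_commensurable (x y : G) :
  commute x y -> x != 1 -> y != 1 ->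
  exists a b : int, [/\ a != 0%R, b != 0%R & expgz x a = expgz y b].
Proof.
move=> cxy x1 y1; apply: contrapT => ncom; apply: wG.1.
apply: (Z2_subgroup cxy) => a b ab1.
have exy : expgz x a = expgz y (- b)
  by rewrite expgzN -(mulg1_eq ab1) invgK.
have [a0|a0] := eqVneq a 0%R.
  by move: ab1; rewrite a0 expgz0 mul1g => /(expgz_eq1 tfG y1).
have [b0|b0] := eqVneq b 0%R.
  by move: ab1; rewrite b0 expgz0 mulg1 => /(expgz_eq1 tfG x1).
by case: ncom; exists a, (- b)%R; rewrite oppr_eq0.
Qed.

(** If [t] generates [K] and [1 != x] is in [N], then [t] can only centralize or
    invert [x], so that [x] and [t ^+ 2] would generate a copy of Z^2. *)
Lemma weakly_AH_no_semidirect (L N K : set G) :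
  is_semidirect_product N K L -> N <> [set 1] -> locally_cyclic N ->
  ~ isomorphic_to K Zgroup.
Proof.
move=> [sgN sgK NK tiNK _] N1 lcN /isomorphic_to_Z[t eK tinj].
have Kt : K t by rewrite eK; exists 1%R.
have [x Nx x1] : exists2 x, N x & x != 1.
  apply: contrapT => noN; apply: N1; apply/seteqP; split=> [x Nx|_ ->].
    by apply/eqP; apply: contra_notT noN => x1; exists x.
  exact: subgroup1.
pose H := generated [set x; x ^ t].
have sHN : H `<=` N.
  by apply: generated_sub => // _ [->|->] //; apply: NK.
have Hx : H x by apply: sub_generated; left.
have Hxt : H (x ^ t) by apply: sub_generated; right.
have [|H1|c eH _] := isomorphic_to_Z (lcN H sHN _ _).
- by exists [set x; x ^ t].
- by case/eqP: x1; move: Hx; rewrite H1.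
move: Hx Hxt; rewrite eH => -[a _ ea] [b _ eb].
have eab : absz a = absz b.
  apply: (wG.2 x x1); exists t.
  by rewrite conj_expgz -eb -[in RHS]ea -!expgzM mulrC.
have cxt2 : commute x (t ^+ 2).
  have : x ^ t = x \/ x ^ t = x^-1.
    rewrite -eb -ea -expgzN.
    (* Here [x = expgz c a] and [x ^ t = expgz c b]. *)
    have [->|->] : b = a \/ b = (- a)%R by lia.
      by left.
    by right.
  case=> ext; apply/commgP/conjg_fixP; rewrite expg2 conjgM.
    by rewrite !ext.
  by rewrite ext conjVg ext invgK.
apply: wG.1; apply: (Z2_subgroup cxt2) => i j xtij.
have t2j : expgz (t ^+ 2) j = expgz t (2 * j)%R by rewrite expgzM.
have xi1 : expgz x i = 1.
  suff : [set (1 : G)] (expgz x i) by [].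
  rewrite -tiNK; split; first exact: subgroup_expgz.
  have -> : expgz x i = expgz t (- (2 * j)).
    by rewrite expgzN -t2j -(mulg1_eq xtij) invgK.
  exact: subgroup_expgz.
split; first exact: expgz_eq1 xi1.
move: xtij; rewrite xi1 mul1g t2j -(expgz0 t) => /tinj /eqP.
by rewrite mulf_eq0 => /predU1P[//|/eqP].
Qed.

End WeaklyAH.

(** * Centralizers in locally indicable groups *)

(** All elements of the subgroup generated by [z], [g], [h] are commensurable
    with [z].  So an epimorphism onto Z does not kill [z], and is therefore
    injective; as its target is abelian, it kills [[~ g, h]]. *)
Lemma locally_indicable_centralizer (G : groupType) (z g h : G) :
  weakly_algebraically_hyperbolic G -> locally_indicable G -> z != 1 ->
  commute z g -> commute z h -> [~ g, h] = 1.
Proof.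
move=> wG liG z1 czg czh; have tfG := weakly_AH_torsion_free wG.
pose H := generated [set z; g; h].
have sgH : subgroup H := subgroup_generated _.
have cHz y : H y -> commute y z.
  apply: (generated_sub (subgroup_centralizer z)) => u [[]|] -> /=.
  - exact: commute_refl.
  - exact: commute_sym.
  - exact: commute_sym.
have Hz : H z by apply: sub_generated; left; left.
have Hg : H g by apply: sub_generated; left; right.
have Hh : H h by apply: sub_generated; right.
have [|H1|f fM fsurj] := liG H.
- by exists [set z; g; h].
- by case/eqP: z1; move: Hz; rewrite H1.
have fX := morph_in_expgz sgH fM.
have fz0 : (f z : int) != 0%R.
  apply/eqP => fz0.
  have [y Hy fy1] : (f @` H) (1%R : int) by rewrite fsurj.
  have [y1|y1] := eqVneq y 1; first by move: fy1; rewrite y1 -(expgz0 z) fX.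
  have [a [b [a0 b0 eyz]]] := weakly_AH_commensurable wG (cHz y Hy) y1 z1.
  have := congr1 f eyz.
  rewrite !fX // !expgz_Zgroup fy1 fz0 mulr0 mulr1 => /eqP.
  by rewrite (negPf a0).
apply/eqP; apply: contraT => gh1; set c := [~ g, h].
have Hc : H c by exact: (subgroup_commg sgH Hg Hh).
have [a [b [a0 b0 ecz]]] := weakly_AH_commensurable wG (cHz c Hc) gh1 z1.
have fc1 : f c = 1.
  have Hgh : H (h * g) by exact: (subgroupM sgH Hh Hg).
  apply: (mulgI (f (h * g))); rewrite -fM; try exact: mem_set.
  rewrite -commgC mulg1 !fM; try exact: mem_set.
  exact: addrC.
have := congr1 f ecz; rewrite !fX // !expgz_Zgroup fc1 mulr0 => /esym/eqP.
by rewrite mulf_eq0 (negPf b0) (negPf fz0).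
Qed.

(** * Central elements of finite groups and transfer *)

(** The transfer from [F] to [K] is trivial on the derived subgroup, while it
    raises a central element of [K] to the power [#|F : K|], which is prime to
    the order of [K]. *)
Lemma abelian_Sylow_center_der1 (gT : finGroupType) (F K : {group gT})
    p (x : gT) :
  p.-Sylow(F) K -> abelian K -> x \in 'C(F) -> x \in K -> x \in F^`(1) -> x = 1.
Proof.
move=> sylK abK cFx Kx F'x; have sKF := pHall_sub sylK.
have abA : abelian (idm K @* K) by rewrite morphim_idm.
pose V := transfer_morphism F abA.
have V'x : V x = 1.
  have /fintype.subsetP/(_ x F'x) : F^`(1) \subset 'ker V; last by move/mker.
  rewrite gen_subG; apply/fintype.subsetP => _ /imset2P[u v Fu Fv ->].
  apply/kerP; first by rewrite groupR.
  rewrite morphR //; apply/eqP/commgP; exact: addrC.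
(* As [x] is central, each of the [#|F : K|] terms of the transfer is [x]. *)
have Vx : V x = (fmod abA x *+ #|F : K|)%R.
  rewrite /V /= /transfer -sumr_const; apply: eq_bigr => _ /rcosetsP[y Fy ->].
  have -> : K :* y :* x = K :* y.
    by rewrite -rcosetM -(centP cFx y Fy) rcosetM (rcoset_id Kx).
  rewrite -(centP cFx (repr (K :* y))) ?mulgK //.
  apply: (fintype.subsetP (mul_subG sKF _)) (mem_repr_rcoset K y).
  by rewrite finset.sub1set.
have xn1 : x ^+ #|F : K| = 1.
  have Ax : x \in idm K @* K by rewrite morphim_idm.
  have := congr1 val Vx; rewrite fmvalZ (fmodK abA Ax) => <-.
  by rewrite V'x; apply: fmval0.
apply/eqP; rewrite -order_eq1 -dvdn1.
have /eqP <- : coprime #|K| #|F : K|.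
  by have := pHall_Hall sylK; rewrite /Hall => /andP[].
by rewrite dvdn_gcd order_dvdG //= order_dvdn xn1.
Qed.

(** A central [p]-element generates a normal [p]-subgroup. *)
Lemma central_p_elt_Sylow (gT : finGroupType) (F K : {group gT}) p (y : gT) :
  p.-Sylow(F) K -> y \in F -> y \in 'C(F) -> p.-elt y -> y \in K.
Proof.
move=> sylK Fy cFy py.
apply: (fintype.subsetP (pcore_sub_Hall sylK)).
rewrite -cycle_subG pcore_max //.
by rewrite /normal cycle_subG Fy cents_norm // centsC cycle_subG.
Qed.

(** An element of order [p] in [K] lies in a cyclic subgroup containing [z],
    so it generates the only subgroup of order [p] of that cyclic subgroup,
    which is inside <z>.  Hence [K] has one subgroup of order [p], so it is
    cyclic or generalized quaternion; but the centre of a quaternion group has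
    order 2, too small to contain the [p]-part of [z]. *)
Lemma cyclic_Sylow_of_central_roots (gT : finGroupType) (F K : {group gT})
    p (z : gT) :
  p.-Sylow(F) K -> prime p -> z \in 'C(F) -> z \in F ->
  (forall u, u \in F -> exists w, (u \in <[w]>) && (z \in <[w]>)) ->
  2 < #[z.`_p] -> cyclic K.
Proof.
move=> sylK p_pr cFz Fz rootz z_gt2.
set y := z.`_p; have py : p.-elt y by apply: p_elt_constt.
have zy : y \in <[z]> by apply: cycle_constt.
have Fy : y \in F by apply: fintype.subsetP zy; rewrite cycle_subG.
have cFy : y \in 'C(F) by apply: fintype.subsetP zy; rewrite cycle_subG.
have sKF := pHall_sub sylK; have pK := pHall_pgroup sylK.
have Ky : y \in K := central_p_elt_Sylow sylK Fy cFy py.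
have K1 : K :!=: 1.
  apply: contraTneq Ky => ->; rewrite inE -order_eq1.
  by case: #[y] z_gt2 => [|[]].
pose Y := 'Ohm_1(<[y]>).
have oY : #|Y| = p.
  apply: Ohm1_cyclic_pgroup_prime (cycle_cyclic y) py _.
  by rewrite cycle_eq1 -order_eq1; case: #[y] z_gt2 => [|[]].
have ohmK : #|'Ohm_1(K)| = p.
  suff -> : 'Ohm_1(K) = Y by [].
  apply/eqP; rewrite finset.eqEsubset andbC OhmS ?cycle_subG //=.
  rewrite (OhmE 1 pK) gen_subG; apply/fintype.subsetP => u.
  rewrite !inE expn1 => /andP[Ku up1].
  have [->|u1] := eqVneq u 1; first exact: group1.
  have ou : #[u] = p by apply/prime_nt_dvdP; rewrite ?order_eq1 // order_dvdn.
  have [w /andP[wu wz]] := rootz u (fintype.subsetP sKF u Ku).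
  have wY : Y \subset <[w]>.
    apply: fintype.subset_trans (Ohm_sub 1 _) _.
    by rewrite cycle_subG; apply: fintype.subsetP zy; rewrite cycle_subG.
  have := eq_subG_cyclic (cycle_cyclic w) (H := <[u]>%G) (K := 'Ohm_1(<[y]>)%G).
  rewrite cycle_subG wu => /(_ isT wY) /=.
  rewrite -orderE ou oY eqxx => /eqP <-.
  exact: cycle_id.
have /orP[//|/andP[/eqP p2 /eqP]] := introT (prime_Ohm1P pK K1) ohmK.
case/quaternion_classP=> n n_gt2 isoK.
have [[a b] genK _] := generators_quaternion n_gt2 isoK.
have [_ _ [_ oZ _ _ _] _ _] := quaternion_structure n_gt2 genK isoK.
have : y \in 'Z(K) by rewrite inE Ky (fintype.subsetP (centS sKF)).
by move/order_dvdG; rewrite oZ => /dvdn_leq -/(_ isT); rewrite leqNgt z_gt2.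
Qed.

(** If the square of [y] were not 1, some [p]-part of [y] would have order
    greater than 2, and so would that of [z]; the Sylow [p]-subgroups would be
    cyclic, and the transfer would kill the [p]-part of [y].

    The exponent 2 cannot be improved to 1: in the quaternion group of order 8,
    the central involution [z] is a power of every non-trivial element and a
    commutator. *)
Lemma central_cycle_der1 (gT : finGroupType) (F : {group gT}) (z y : gT) :
  z \in 'C(F) -> z \in F ->
  (forall u, u \in F -> exists w, (u \in <[w]>) && (z \in <[w]>)) ->
  y \in <[z]> -> y \in F^`(1) -> y ^+ 2 = 1.
Proof.
move=> cFz Fz rootz zy F'y; apply/eqP; apply: contraT => y2.
have [p p_pr pd] : exists2 p, prime p & p %| #[y ^+ 2].
  exists (pdiv #[y ^+ 2]); last exact: pdiv_dvd.
  by apply: pdiv_prime; rewrite ltn_neqAle eq_sym order_eq1 y2 order_gt0.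
have yp2 : y.`_p ^+ 2 != 1.
  by rewrite -consttX; apply/eqP => /constt1P; rewrite /p_elt p'natE // pd.
have oyp : 2 < #[y.`_p].
  rewrite ltnNge; apply: contra yp2; rewrite -order_dvdn.
  case: #[y.`_p] (order_gt0 y.`_p) => [|[|[|]]] //.
have oyz : #[y.`_p] %| #[z.`_p].
  by rewrite !order_constt; apply: partn_dvd (order_dvdG zy).
have ozp : 2 < #[z.`_p] by exact: leq_trans oyp (dvdn_leq (order_gt0 _) oyz).
have [K sylK] := Sylow_exists p F.
have cycK := cyclic_Sylow_of_central_roots sylK p_pr cFz Fz rootz ozp.
have F'yp : y.`_p \in F^`(1).
  by apply: fintype.subsetP (cycle_constt p y); rewrite cycle_subG.
have cFyp : y.`_p \in 'C(F).
  apply: fintype.subsetP (cycle_constt p y); rewrite cycle_subG.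
  by apply: fintype.subsetP zy; rewrite cycle_subG.
have Fyp : y.`_p \in F by apply: fintype.subsetP F'yp; apply: der_sub.
have Kyp := central_p_elt_Sylow sylK Fyp cFyp (p_elt_constt p y).
have yp1 := abelian_Sylow_center_der1 sylK (cyclic_abelian cycK) cFyp Kyp F'yp.
by move: yp2; rewrite yp1 expg1n eqxx.
Qed.

(** * Centralizers in residually finite groups *)

Section CosetAction.
Variables (G : groupType) (H : set G) (s : seq (set G)).
Hypothesis sgH : subgroup H.

Let translate (g : G) (A : set G) : set G := [set g * a | a in A].

Hypothesis eq_s : [set translate x H | x in [set: G]] = [set` s].

Let translateM g h A : translate g (translate h A) = translate (g * h) A.
Proof.
apply/seteqP; split=> [_ [_ [a Aa <-] <-]|_ [a Aa <-]].
  by exists a => //; rewrite mulgA.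
by exists (h * a); [exists a | rewrite mulgA].
Qed.

Let translate1 A : translate 1 A = A.
Proof.
apply/seteqP; split=> [_ [a Aa <-]|a Aa]; first by rewrite mul1g.
by exists a => //; rewrite mul1g.
Qed.

Let translate_mem g (u : seq_sub s) : translate g^-1 (val u) \in s.
Proof.
have : [set` s] (val u) by exact: (valP u).
rewrite -eq_s => -[x _ <-]; rewrite translateM.
suff : [set` s] (translate (g^-1 * x) H) by [].
by rewrite -eq_s; exists (g^-1 * x).
Qed.

Let act g (u : seq_sub s) : seq_sub s := SeqSub (translate_mem g u).

Let act_inj g : injective (act g).
Proof.
move=> u v /(congr1 val) /= /(congr1 (translate g)).
by rewrite !translateM mulgV !translate1 => /val_inj.
Qed.

(** Left translation by the inverse of [g], because permutations are composed
    from left to right. *)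
Definition coset_perm (g : G) : {perm seq_sub s} := perm (@act_inj g).

Lemma coset_permM : {morph coset_perm : g h / g * h}.
Proof.
move=> g h; apply/permP => u; rewrite permM !permE; apply/val_inj => /=.
by rewrite translateM invgM.
Qed.

(** A trivial permutation fixes the coset [H] itself. *)
Lemma coset_perm_eq1 g : coset_perm g = 1 -> H g.
Proof.
move=> g1; have sH : H \in s.
  suff : [set` s] H by [].
  by rewrite -eq_s; exists 1 => //; rewrite translate1.
have := congr1 (fun p : {perm _} => val (p (SeqSub sH))) g1.
rewrite permE perm1 /= => eH; rewrite -[g]invgK; apply: subgroupV => //.
by rewrite -eH; exists 1; [apply: subgroup1 | rewrite mulg1].
Qed.

End CosetAction.

(** The quotient is obtained as a group of permutations of the cosets of a
    subgroup of finite index avoiding [x], which need not be normal. *)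
Lemma residually_finite_quotient (G : groupType) (x : G) :
  residually_finite G -> x != 1 ->
  exists (gT : finGroupType) (f : G -> gT),
    {morph f : y z / y * z} /\ f x != 1.
Proof.
move=> rfG x1.
have [H [sgH fiH Hx]] :
    exists H : set G, [/\ subgroup H, finite_index H & ~ H x].
  apply: contrapT => noH; case/eqP: x1; suff : [set (1 : G)] x by [].
  rewrite -rfG => H [sgH fiH]; apply: contrapT => Hx.
  by apply: noH; exists H.
have [s eq_s] := (finite_seqP _).1 fiH.
exists {perm seq_sub s}, (coset_perm eq_s); split; first exact: coset_permM.
by apply/eqP => /(coset_perm_eq1 sgH).
Qed.

Lemma expgz_cycle (gT : finGroupType) (x : gT) m : expgz x m \in <[x]>.
Proof. by case: m => k /=; rewrite ?groupV mem_cycle. Qed.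

(** Suppose that [c = [~ g, h]] is non-trivial, so that a non-zero power
    [expgz z b] is also a power of [c].  The finite quotient is chosen to keep
    the square of [expgz z b], since [central_cycle_der1] only controls
    elements of the derived subgroup up to their squares. *)
Lemma residually_finite_centralizer (G : groupType) (z g h : G) :
  weakly_algebraically_hyperbolic G -> residually_finite G -> z != 1 ->
  commute z g -> commute z h -> [~ g, h] = 1.
Proof.
move=> wG rfG z1 czg czh; have tfG := weakly_AH_torsion_free wG.
apply/eqP; apply: contraT => gh1; set c := [~ g, h].
have sgC := subgroup_centralizer z.
have ccz : commute c z.
  exact: (subgroup_commg sgC (commute_sym czg) (commute_sym czh)).
have [a [b [a0 b0 ecz]]] := weakly_AH_commensurable wG ccz gh1 z1.
have zb2 : expgz z (b * Posz 2)%R != 1.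
  apply/eqP => /(expgz_eq1 tfG z1)/eqP.
  by rewrite mulf_eq0 (negPf b0).
have [gT [f [fM fzb2]]] := residually_finite_quotient rfG zb2.
have fX := morph_expgz fM.
have f1 : f 1 = 1 by rewrite -(expgz0 z) fX.
have fV u : f u^-1 = (f u)^-1 by exact: (fX u (- 1)%R).
pose F := [set u : gT | `[< exists2 y : G, commute y z & f y = u >]]%SET.
have memF y : commute y z -> f y \in F.
  by move=> cyz; rewrite inE; apply/asboolP; exists y.
have gF : group_set F.
  apply/group_setP; split.
    by rewrite -f1; apply/memF/(subgroup1 sgC).
  move=> u v; rewrite !inE => /asboolP[y cy <-] /asboolP[w cw <-].
  by apply/asboolP; exists (y * w); [exact: (subgroupM sgC) | apply: fM].
pose FG := Group gF.
have Fz : f z \in FG by apply: memF.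
have cFz : f z \in 'C(FG).
  apply/centP => u; rewrite !inE => /asboolP[y cy <-].
  by rewrite /commute -!fM cy.
have cycF u : u \in FG -> exists w, (u \in <[w]>) && (f z \in <[w]>).
  rewrite inE => /asboolP[y cy <-].
  have [->|y1] := eqVneq y 1; first by exists (f z); rewrite f1 group1 cycle_id.
  have [i [j [i0 _ eyz]]] := weakly_AH_commensurable wG cy y1 z1.
  have [w [_ [k ->] [l ->]]] := common_root tfG cy i0 eyz.
  by exists (f w); rewrite !fX !expgz_cycle.
have zF : f (expgz z b) \in <[f z]> by rewrite fX expgz_cycle.
have F'z : f (expgz z b) \in FG^`(1).
  rewrite -ecz fX; have F'c : f c \in FG^`(1).
    have -> : f c = [~ f g, f h] by rewrite /c commgEl conjgE !fM !fV.
    by apply: mem_commg; apply: memF; apply/commute_sym.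
  by apply: fintype.subsetP (expgz_cycle _ _); rewrite cycle_subG.
have := central_cycle_der1 cFz Fz cycF zF F'z.
move/eqP; rewrite (_ : _ ^+ 2 = f (expgz z (b * Posz 2)%R)) ?(negPf fzb2) //.
by rewrite expgzM [RHS]fX.
Qed.

(** * The equivalence *)

Theorem theoremC (G : groupType)
    (hG : locally_indicable G \/ (torsion_free G /\ residually_finite G)) :
  weakly_algebraically_hyperbolic G <-> algebraically_hyperbolic G.
Proof.
split; last exact: AH_weakly_AH.
move=> wG; split; first exact: weakly_AH_torsion_free.
  move=> g h k _ h1 _ /eqP/commgP cgh /eqP/commgP chk.
  case: hG => [liG|[_ rfG]].
    exact: (locally_indicable_centralizer wG liG h1 (commute_sym cgh) chk).
  exact: (residually_finite_centralizer wG rfG h1 (commute_sym cgh) chk).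
case=> L [N [K [_ NKL N1 lcN KZ]]].
exact: (weakly_AH_no_semidirect wG NKL N1 lcN KZ).
Qed.
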